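(* Let $0<m\le M<\infty$, $\rho>0$, and let $l\ge1$ be an integer. There exist positive constants $C_1,C_2,\epsilon_0$ depending only on $m,M,l,\rho$ such that the following holds. Let $N>0$, $0<\epsilon\le\epsilon_0$, and put $h_\epsilon=\frac1N\left(\frac{\epsilon}{C_2}\right)^{\frac{1}{2l-1}}$. Let $F^0=F_{A^0,X^0}$ be any signal with $d\geq l$ nodes satisfying assumption $A(m,M)$ and forming an $(l,h_\epsilon,\rho)$-cluster $X^0_l=\{x^0_\kappa,\ldots,x^0_{\kappa+l-1}\}$. Then there is a signal $F^1=F_{A^1,X^1}$ with $d$ nodes, satisfying assumption $A(\frac m2,2M)$, such that, with $X^1_l=\{x^1_\kappa,\ldots,x^1_{\kappa+l-1}\}$: (i) $d(X^0_l,X^1_l)\ge C_1h_\epsilon$ and $|\mathcal{F}(F^0)(s)-\mathcal{F}(F^1)(s)|\le C_2|h_\epsilon s|^{2l-1}$ for all real $s$ with $|s|\le\frac{1}{2\pi h_\epsilon}$; (ii) for any reconstruction algorithm $\mathcal{R}$, the worst-case error (over all admissible noises) in the reconstruction of the nodes of either $X^0_l$ or $X^1_l$ is not smaller than $\frac12C_1h_\epsilon$; that is, there are $i\in\{0,1\}$ and a noise function $\nu:[-N,N]\to\mathbb{C}$ with $|\nu(s)|\le\epsilon$ for all $s\in[-N,N]$ such that the output $(\hat A,\hat X)=\mathcal{R}(\Phi)$ of the algorithm on the measurement $\Phi=\mathcal{F}(F^i)|_{[-N,N]}+\nu$ satisfies $d(X^i_l,\hat X_l)\ge\frac12C_1h_\epsilon$,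 where $\hat X_l=\{\hat x_\kappa,\ldots,\hat x_{\kappa+l-1}\}$.
   Context: A signal with $d$ nodes is $F_{A,X}(x)=\sum_{j=1}^d a_j\delta(x-x_j)$, where $\delta$ is the Dirac delta, $A=(a_1,\ldots,a_d)\in\mathbb{R}^d$ are the amplitudes and $X=(x_1,\ldots,x_d)\in\mathbb{R}^d$ are the nodes, always ordered so that $x_1\le x_2\le\cdots\le x_d$. Its Fourier transform is $\mathcal{F}(F)(s)=\int_{-\infty}^{\infty}F(x)e^{-isx}\,dx$, i.e. $\mathcal{F}(F_{A,X})(s)=\sum_{j=1}^d a_je^{-isx_j}$. Assumption $A(m,M)$: $0<m\le|a_j|\le M<\infty$ for $j=1,\ldots,d$ (and $A(\frac m2,2M)$ is the same condition with $m,M$ replaced by $\frac m2,2M$). A signal $F_{A,X}$ forms an $(l,h,\rho)$-cluster if there is an interval $I\subset\mathbb{R}$ of length $h$ which contains exactly $l$ nodes $X_l=\{x_\kappa,x_{\kappa+1},\ldots,x_{\kappa+l-1}\}$ of $F_{A,X}$, while the minimal distance between the nodes in $X_l$ is at least $\rho h$, $\rho>0$. For two ordered subsets $V=(v_1,\ldots,v_q)$ and $W=(w_1,\ldots,w_q)$ of $\mathbb{R}$, $d(V,W)=\max_{1\le s\le q}|v_s-w_s|$. The measurement of a signal $F$ is the restriction of $\mathcal{F}(F)$ to $[-N,N]$ corrupted by a noise, which may be an arbitrary function $\nu$ on $[-N,N]$ with the only restriction $|\nu(s)|\le\epsilon$. A reconstruction algorithm $\mathcal{R}$ is an arbitrary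 map which assigns to each measured function $\Phi:[-N,N]\to\mathbb{C}$ parameters $(\hat A,\hat X)\in\mathbb{R}^d\times\mathbb{R}^d$. *)

(* Defs.v *)
(* MathComp + MathComp-Analysis, with complex numbers R[i] over R : realType. *)
From HB Require Import structures.
From mathcomp Require Import all_boot all_order all_algebra.
From mathcomp Require Import complex.
From mathcomp Require Import reals exp trigo.

Set Implicit Arguments.
Unset Strict Implicit.
Unset Printing Implicit Defensive.

Import Order.TTheory GRing.Theory Num.Theory.

Local Open Scope ring_scope.
Local Open Scope complex_scope.

(* The signal F_{A,X} is given by its parameters. Coordinates are numbered
   from 0, and repeated nodes count with multiplicity. *)
Record signal (R : realType) (d : nat) := Signal {
  amp : 'rV[R]_d;
  node : 'rV[R]_d;
  node_ordered : forall i j : 'I_d, (i <= j)%N -> node 0 i <= node 0 j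
}.

Definition expi (R : realType) (t : R) : R[i] := cos t +i* sin t.

(* The integral of F_{A,X}(x) e^{-isx}: each delta is evaluated at its node. *)
Definition fourier (R : realType) (d : nat) (F : signal R d) (s : R) : R[i] :=
  \sum_(j < d) (amp F 0 j)%:C * expi (- (s * node F 0 j)).

Definition amp_assumption (R : realType) (d : nat) (m M : R)
    (F : signal R d) : Prop :=
  0 < m /\ forall j : 'I_d, m <= `|amp F 0 j| <= M.

(* The coordinates kappa, ..., kappa + l - 1 of X. *)
Definition subnodes (R : realType) (d kappa l : nat)
    (kl_le_d : (kappa + l <= d)%N) (X : 'rV[R]_d) : 'rV[R]_l :=
  \row_(s < l) X 0 (widen_ord kl_le_d (rshift kappa s)).

(* The interval I has endpoints a and a + h, each of which may be included or
   excluded. *)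
Definition forms_cluster (R : realType) (d kappa l : nat)
    (kl_le_d : (kappa + l <= d)%N) (h rho : R) (F : signal R d) : Prop :=
  (exists (a : R) (b1 b2 : bool),
     forall j : 'I_d,
       (node F 0 j \in Interval (BSide b1 a) (BSide b2 (a + h))) =
       (kappa <= j < kappa + l)%N) /\
  (forall s t : 'I_l, s != t ->
     rho * h <= `|subnodes kl_le_d (node F) 0 s -
                  subnodes kl_le_d (node F) 0 t|).

(* The terms are nonnegative, so the default value 0 matters only for q = 0. *)
Definition dist_nodes (R : realType) (q : nat) (V W : 'rV[R]_q) : R :=
  \big[Num.max/0]_(s < q) `|V 0 s - W 0 s|.

Definition band (R : realType) (N : R) : Type := {s : R | s \in `[- N, N]}.

Definition measured (R : realType) (N : R) : Type := band N -> R[i].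

(* The output nodes are not required to be ordered. *)
Definition algorithm (R : realType) (N : R) (d : nat) : Type :=
  measured N -> 'rV[R]_d * 'rV[R]_d.

Definition admissible_noise (R : realType) (N eps : R) (nu : measured N) :
    Prop :=
  forall s : band N, `|nu s| <= eps%:C.

Definition measurement (R : realType) (N : R) (d : nat) (F : signal R d)
    (nu : measured N) : measured N :=
  fun s => fourier F (val s) + nu s.

(* Main.v *)
Require Import Defs.
From HB Require Import structures.
From mathcomp Require Import all_boot all_order all_algebra.
From mathcomp Require Import complex.
From mathcomp Require Import reals exp trigo.
From mathcomp Require Import perm ring lra.
From mathcomp Require Import boolp functions topology normedtype derive realfun.

Set Implicit Arguments.
Unset Strict Implicit.
Unset Printing Implicit Defensive.

Import Order.TTheory GRing.Theory Num.Theory.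
Import numFieldNormedType.Exports.

Local Open Scope ring_scope.
Local Open Scope complex_scope.

(** Rescale the cluster to the unit interval: amplitudes a_j, nodes x_j that are
    rho-separated. A companion cluster with amplitudes b_j and nodes y_j is
    indistinguishable from it up to order (h s)^(2l-1) as soon as the two share
    the moments of order 0, ..., 2l-2. These are 2l-1 equations for 2l unknowns,
    and the curve of solutions has an explicit description. A combination of
    evaluations at 2l points that kills all polynomials of degree at most 2l-2
    is a multiple of the divided difference, whose weight at a point z is
    1/W'(z), where W is the monic polynomial vanishing at the 2l points. Let
    P = prod (X - x_i), Q = prod (X - y_i), W = P Q. The weights at the x_j are
    proportional to the a_j exactly when Q(x_j) = c / (a_j P'(x_j)) for some
    constant c, that is, when Q = P + c S with S the polynomial of degree less
    than l that takes the value 1 / (a_j P'(x_j)) at x_j. The new amplitudes are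
    then b_j = 1 / (S(y_j) Q'(y_j)) ([moments_eq]).

    For |c| small, in terms of m, M, l and rho only, Q changes sign around each
    x_j, so it has a root y_j there ([pencil_roots]), b_j stays close to a_j
    ([interp_conodal_near]), and any one chosen node moves by at least a constant
    times |c|, in the direction that the sign of c prescribes
    ([cluster_perturbation]).

    Nodes outside the cluster may lie arbitrarily close to it, so after the
    perturbation the nodes may have to be sorted again, and a displaced node
    may leave its position. The direction in which the first node of the cluster
    moves is therefore chosen so that there is room for it: to the right if
    possible, and otherwise, which happens only for a single node in the right
    half of the interval, to the left ([cluster_rescale]). A counting argument
    ([sorting_perm_ge], [sorting_perm_le]) shows that the sorted position of
    this node still records a displacement of at least C1 h.

    Equality of moments turns into the bound on Fourier transforms by repeated
    application of the mean value theorem ([trig_sum_le]). The lower bound for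
    algorithms is then the usual two-point argument: the noise
    F(F^0) - F(F^1) added to F(F^1) produces the noiseless measurement of F^0,
    and one output cannot be close to both node vectors. *)

(** * Products of bounded factors *)

Lemma norm_prod_le (R : realFieldType) (I : finType) (P : pred I) (u : I -> R)
    (B : R) :
  1 <= B -> (forall i, P i -> `|u i| <= B) ->
  `|\prod_(i | P i) u i| <= B ^+ #|I|.
Proof.
move=> B1 uB; rewrite normr_prod.
apply: (@le_trans _ _ (\prod_(i | P i) B)).
  by apply: ler_prod => i Pi; rewrite normr_ge0 uB.
rewrite prodr_const; apply: ler_weXn2l => //; exact: max_card.
Qed.

(** One factor is exchanged at a time. The bound is crude (it uses #|I| for the
    number of factors), as only its dependence on e matters. *)
Lemma prod_lipschitz (R : realFieldType) (I : finType) (P : pred I)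
    (u v : I -> R) (B e : R) :
  1 <= B -> 0 <= e -> (forall i, P i -> `|u i| <= B) ->
  (forall i, P i -> `|v i| <= B) -> (forall i, P i -> `|u i - v i| <= e) ->
  `|\prod_(i | P i) u i - \prod_(i | P i) v i| <= #|I|%:R * B ^+ #|I| * e.
Proof.
move=> B1 e0 uB vB uve; have B0 : 0 <= B := le_trans ler01 B1.
have -> : #|I| = size (index_enum I) by rewrite cardE enumT; unlock index_enum.
suff H s : `|\prod_(i <- s | P i) u i| <= B ^+ size s /\
  `|\prod_(i <- s | P i) u i - \prod_(i <- s | P i) v i|
     <= (size s)%:R * B ^+ size s * e.
  by have [] := H (index_enum I).
elim: s => [|i s [IHu IH]]; first by rewrite !big_nil subrr !normr0 normr1 !mul0r.
rewrite !big_cons /=; case: ifP => Pi; last first.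
  have BS : B ^+ size s <= B ^+ (size s).+1 by apply: ler_weXn2l.
  split; first exact: le_trans BS.
  apply: le_trans IH _; apply: ler_wpM2r => //.
  by apply: ler_pM; rewrite ?ler0n ?exprn_ge0 ?ler_nat.
set U := \prod_(_ <- _ | _) _ in IHu IH *; set V := \prod_(_ <- _ | _) _ in IH *.
split; first by rewrite normrM exprS ler_pM // uB.
have -> : u i * U - v i * V = (u i - v i) * U + v i * (U - V) by ring.
apply: le_trans (ler_normD _ _) _; rewrite !normrM exprS -natr1.
have BS : B ^+ size s <= B * B ^+ size s by rewrite ler_peMl // exprn_ge0.
have h1 : `|u i - v i| * `|U| <= e * (B * B ^+ size s).
  apply: ler_pM => //; first exact: uve.
  exact: le_trans BS.
have h2 : `|v i| * `|U - V| <= B * ((size s)%:R * B ^+ size s * e).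
  by apply: ler_pM => //; exact: vB.
apply: le_trans (lerD h1 h2) _.
by rewrite le_eqVlt; apply/orP; left; apply/eqP; ring.
Qed.

Lemma norm_prod_ge (R : realFieldType) (I : finType) (P : pred I) (u : I -> R)
    (B : R) :
  0 <= B <= 1 -> (forall i, P i -> B <= `|u i|) ->
  B ^+ #|I| <= `|\prod_(i | P i) u i|.
Proof.
move=> /andP[B0 B1] uB; rewrite normr_prod.
apply: (@le_trans _ _ (\prod_(i | P i) B)); last first.
  by apply: ler_prod => i Pi; rewrite B0 uB.
rewrite prodr_const; apply: ler_wiXn2l => //; exact: max_card.
Qed.

(** * Divided differences and equality of moments *)

Lemma size_prod_XsubC_except (F : fieldType) (I : finType) (z : I -> F) (i : I) :
  size (\prod_(k | k != i) ('X - (z k)%:P)) = #|I|.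
Proof.
rewrite -big_enum size_prod_XsubC -cardE (cardC1 i).
by apply: prednK; apply/card_gt0P; exists i.
Qed.

(** The left-hand side is the coefficient of degree #|I| - 1 of the Lagrange
    interpolant of p, which is p itself. *)
Lemma sum_div_prod_eq0 (F : fieldType) (I : finType) (z : I -> F)
    (p : {poly F}) :
  injective z -> (size p < #|I|)%N ->
  \sum_i p.[z i] / \prod_(k | k != i) (z i - z k) = 0.
Proof.
move=> injz sp.
pose w i := \prod_(k | k != i) (z i - z k).
have w0 i : w i != 0.
  apply/prodf_neq0 => k ki; rewrite subr_eq0; apply: contra ki => /eqP /injz ->.
  by [].
pose L i := \prod_(k | k != i) ('X - (z k)%:P).
pose q := \sum_i (p.[z i] / w i) *: L i.
have Lz i j : (L i).[z j] = if i == j then w i else 0.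
  rewrite horner_prod; case: eqP => [<-|/eqP ij].
    by apply: eq_bigr => k _; rewrite hornerXsubC.
  by rewrite (bigD1 j) 1?eq_sym //= hornerXsubC subrr mul0r.
have qz j : q.[z j] = p.[z j].
  rewrite horner_sum (bigD1 j) //= big1 => [|i ij]; last first.
    by rewrite hornerZ Lz (negPf ij) mulr0.
  by rewrite hornerZ Lz eqxx addr0 divfK.
have sL i : size (L i) = #|I| by exact: size_prod_XsubC_except.
have sq : (size q <= #|I|)%N.
  apply: leq_trans (size_sum _ _ _) _; apply/bigmax_leqP => i _.
  by rewrite (leq_trans (size_scale_leq _ _)) ?sL.
have pq : q - p = 0.
  apply: (@roots_geq_poly_eq0 _ _ [seq z i | i <- enum I]).
  - by apply/allP => _ /mapP[i _ ->]; rewrite /root !hornerE qz subrr.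
  - by rewrite map_inj_uniq ?enum_uniq.
  rewrite size_map -cardE (leq_trans (size_polyD _ _)) // geq_max sq size_polyN.
  exact: ltnW.
have := congr1 (fun r : {poly F} => r`_#|I|.-1) pq.
rewrite coefB coef0 (@nth_default _ _ p); last by case: #|I| sp.
rewrite subr0 coef_sum => q0; rewrite -[RHS]q0; apply: eq_bigr => i _.
rewrite coefZ; have /monicP := monic_prod_XsubC (index_enum I) (fun k => k != i) z.
by rewrite lead_coefE [size _]sL => ->; rewrite mulr1.
Qed.

(** At t = x j this is P'(x j), where P = prod (X - x k). *)
Definition conodal (R : comNzRingType) (I : finType) (x : I -> R) (j : I)
    (t : R) : R :=
  \prod_(k | k != j) (t - x k).

Definition interp_weight (R : fieldType) (I : finType) (a x : I -> R) (k : I) : R :=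
  (a k * conodal x k (x k) ^+ 2)^-1.

(** The value at t of the Lagrange interpolant S of the data 1 / (a_j P'(x_j)) at
    the nodes x_j; see [interp_node]. *)
Definition interp (R : fieldType) (I : finType) (a x : I -> R) (t : R) : R :=
  \sum_k interp_weight a x k * conodal x k t.

(** The polynomial P + c S, whose roots are the displaced nodes. *)
Definition pencil (R : fieldType) (I : finType) (a x : I -> R) (c : R) : {poly R} :=
  \prod_i ('X - (x i)%:P) +
  c *: \sum_k interp_weight a x k *: \prod_(i | i != k) ('X - (x i)%:P).

Lemma horner_pencil (R : fieldType) (I : finType) (a x : I -> R) (c t : R) :
  (pencil a x c).[t] = \prod_i (t - x i) + c * interp a x t.
Proof.
rewrite hornerD hornerZ horner_sum horner_prod; congr (_ + c * _).
  by apply: eq_bigr => i _; rewrite hornerXsubC.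
apply: eq_bigr => k _; rewrite hornerZ horner_prod; congr (_ * _).
by apply: eq_bigr => i _; rewrite hornerXsubC.
Qed.

Lemma prod_conodal (R : comNzRingType) (I : finType) (x : I -> R) (j : I) (t : R) :
  \prod_i (t - x i) = (t - x j) * conodal x j t.
Proof. by rewrite (bigD1 j). Qed.

Lemma interp_node (R : fieldType) (I : finType) (a x : I -> R) (j : I) :
  conodal x j (x j) != 0 ->
  interp a x (x j) * conodal x j (x j) = (a j)^-1.
Proof.
move=> w0; rewrite /interp (bigD1 j) //= big1 ?addr0 => [|k kj].
  by rewrite /interp_weight invfM -!mulrA -expr2 mulVf ?mulr1 // expf_neq0.
by rewrite /conodal (bigD1 j) 1?eq_sym //= subrr mul0r mulr0.
Qed.

Lemma pencil_factor (R : fieldType) (I : finType) (a x y : I -> R) (c : R) :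
  injective y -> (forall j, root (pencil a x c) (y j)) ->
  pencil a x c = \prod_i ('X - (y i)%:P).
Proof.
move=> injy rooty.
have sP (z : I -> R) : size (\prod_i ('X - (z i)%:P)) = #|I|.+1.
  by rewrite -big_enum size_prod_XsubC -cardE.
have sS : (size (pencil a x c - \prod_i ('X - (x i)%:P))%R <= #|I|)%N.
  rewrite /pencil addrC addKr (leq_trans (size_scale_leq _ _)) //.
  apply: leq_trans (size_sum _ _ _) _; apply/bigmax_leqP => k _.
  by rewrite (leq_trans (size_scale_leq _ _)) // size_prod_XsubC_except.
have sD : (size (\prod_i ('X - (x i)%:P) - \prod_i ('X - (y i)%:P))%R
            <= #|I|)%N.
  apply/leq_sizeP => k; rewrite leq_eqVlt => /orP[/eqP <-|lt_k].
    have lc (z : I -> R) : (\prod_i ('X - (z i)%:P))`_#|I| = 1.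
      have /monicP := monic_prod_XsubC (index_enum I) xpredT z.
      by rewrite lead_coefE sP.
    by rewrite coefB !lc subrr.
  by rewrite coefB !nth_default ?subrr // sP.
apply/eqP; rewrite -subr_eq0; apply/eqP.
apply: (@roots_geq_poly_eq0 _ _ [seq y i | i <- enum I]).
- apply/allP => _ /mapP[i _ ->]; rewrite /root hornerD hornerN (eqP (rooty i)).
  rewrite sub0r oppr_eq0 horner_prod (bigD1 i) //= hornerXsubC subrr mul0r.
  by [].
- by rewrite map_inj_uniq ?enum_uniq.
rewrite size_map -cardE -(subrK (\prod_i ('X - (x i)%:P)) (pencil _ _ _)) -addrA.
by rewrite (leq_trans (size_polyD _ _)) // geq_max sS.
Qed.

(** At x_j the derivative of W = P Q is P'(x_j) Q(x_j) = c P'(x_j) S(x_j) = c / a_j,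
    and at y_j it is P(y_j) Q'(y_j) = - c S(y_j) Q'(y_j), so that the identity
    [sum_div_prod_eq0] for W is the equality of the two sums. That S does not
    vanish at the y_j keeps them away from the x_i. *)
Lemma moments_eq (R : fieldType) (I : finType) (a x y : I -> R)
    (c : R) (p : {poly R}) :
  c != 0 -> (forall j, a j != 0) ->
  injective x -> injective y ->
  (forall j, root (pencil a x c) (y j)) ->
  (forall j, interp a x (y j) != 0) ->
  (size p < #|I| + #|I|)%N ->
  \sum_j a j * p.[x j] =
  \sum_j (interp a x (y j) * conodal y j (y j))^-1 * p.[y j].
Proof.
move=> c0 a0 injx injy rooty Sy0 sp.
have fact := pencil_factor injy rooty.
have wx0 j : conodal x j (x j) != 0.
  by apply/prodf_neq0 => k kj; rewrite subr_eq0 (inj_eq injx) eq_sym.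
have Py j : \prod_i (y j - x i) = - (c * interp a x (y j)).
  by apply/eqP; rewrite -addr_eq0 -horner_pencil; exact: rooty.
have Qx j : \prod_i (x j - y i) = c * interp a x (x j).
  have : (pencil a x c).[x j] = \prod_i (x j - y i).
    rewrite fact horner_prod; apply: eq_bigr => i _; exact: hornerXsubC.
  by rewrite horner_pencil (prod_conodal x j) subrr mul0r add0r.
have xy j i : y j != x i.
  have : \prod_i (y j - x i) != 0 by rewrite Py oppr_eq0 mulf_neq0.
  by move/prodf_neq0/(_ i isT); rewrite subr_eq0.
pose z (u : I + I) := match u with inl i => x i | inr i => y i end.
have injz : injective z.
  move=> [i|i] [k|k] /=.
  - by move/injx ->.
  - by move/esym/eqP; rewrite (negPf (xy _ _)).
  - by move/eqP; rewrite (negPf (xy _ _)).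
  - by move/injy ->.
(* z lists the 2l roots of W. *)
have := sum_div_prod_eq0 injz (p := p).
rewrite card_sum => /(_ sp); rewrite big_sumType /=.
under eq_bigr => j _.
  rewrite big_sumType /= -[\prod_(i | inl i != inl j) _]/(conodal x j (x j)) Qx.
  rewrite mulrCA (mulrC (conodal _ _ _)) interp_node // invfM invrK mulrCA.
  rewrite [_.[_] * _]mulrC.
  over.
under [X in _ + X]eq_bigr => j _.
  rewrite big_sumType /= -[\prod_(i | inr i != inr j) _]/(conodal y j (y j)) Py.
  rewrite mulNr -mulrA invrN mulrN invfM mulrCA -mulrN [_.[_] * _]mulrC.
  over.
rewrite -!mulr_sumr -mulrDr => /eqP; rewrite mulf_eq0 invr_eq0 (negPf c0) /=.
by rewrite sumrN subr_eq0 => /eqP.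
Qed.

(** * Displacement of a well-separated cluster *)

Definition unit_cluster (R : realFieldType) (I : finType) (rho : R) (x : I -> R) :=
  (forall i, 0 <= x i <= 1) /\
  (forall i k, i != k -> rho <= `|x i - x k|).

Lemma unit_cluster_inj (R : realFieldType) (I : finType) (rho : R) (x : I -> R) :
  0 < rho -> unit_cluster rho x -> injective x.
Proof.
move=> rho0 [_ sep] i k xik; apply/eqP/negPn/negP => /sep.
by rewrite xik subrr normr0 leNgt rho0.
Qed.

Lemma interp_weight_le (R : realFieldType) (I : finType) (m rho : R)
    (a x : I -> R) (k : I) :
  0 < m -> 0 < rho <= 1 -> m <= `|a k| -> unit_cluster rho x ->
  `|interp_weight a x k| <= (m * rho ^+ #|I| ^+ 2)^-1.
Proof.
move=> m0 /andP[rho0 rho1] am [_ sep].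
have le_w : rho ^+ #|I| <= `|conodal x k (x k)|.
  by apply: norm_prod_ge => [|i ik]; rewrite ?(ltW rho0) // sep // eq_sym.
have rn0 : 0 < rho ^+ #|I| by rewrite exprn_gt0.
have w0 : 0 < `|conodal x k (x k)| by exact: lt_le_trans le_w.
have a0 : 0 < `|a k| by exact: lt_le_trans am.
rewrite normfV normrM normrX lef_pV2 ?posrE ?mulr_gt0 ?exprn_gt0 //.
by rewrite ler_pM ?ler_pXn2r ?nnegrE ?sqr_ge0 ?(ltW m0) ?(ltW rn0) ?(ltW w0).
Qed.

Lemma interp_le (R : realFieldType) (I : finType) (m rho : R)
    (a x : I -> R) (t : R) :
  0 < m -> 0 < rho <= 1 -> (forall k, m <= `|a k|) -> unit_cluster rho x ->
  (forall k, `|t - x k| <= 2) ->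
  `|interp a x t| <= #|I|%:R * (m * rho ^+ #|I| ^+ 2)^-1 * 2 ^+ #|I|.
Proof.
move=> m0 rho01 am ux tx; apply: le_trans (ler_norm_sum _ _ _) _.
rewrite -mulrA mulr_natl -sumr_const; apply: ler_sum => k _.
rewrite normrM ler_pM // ?interp_weight_le //.
by apply: norm_prod_le => // ; rewrite ler1n.
Qed.

Lemma sep_factor (R : realFieldType) (rho d t : R) :
  rho <= `|d| -> `|t| <= rho / 2 -> `|d| * (rho / 2) <= d * (d + t).
Proof.
move=> rd; rewrite ler_norml => /andP[t1 t2].
have [d0|d0] := ger0P d; rewrite ?(ger0_norm d0) ?(ltr0_norm d0) in rd *; nra.
Qed.

(** Moving the point x j by at most half the separation changes the sign of no
    factor x j - x k, and divides its size by at most 2. *)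
Lemma conodal_same_sign (R : realFieldType) (I : finType) (rho : R) (x : I -> R)
    (j : I) (t : R) :
  0 < rho <= 1 -> unit_cluster rho x -> `|t| <= rho / 2 ->
  `|conodal x j (x j)| * (rho / 2) ^+ #|I|
    <= conodal x j (x j) * conodal x j (x j + t).
Proof.
move=> /andP[rho0 rho1] [_ sep] trho; rewrite /conodal -big_split /=.
apply: (@le_trans _ _ (\prod_(k | k != j) (`|x j - x k| * (rho / 2)))).
  rewrite big_split /= normr_prod prodr_const ler_wpM2l //.
    by apply: prodr_ge0.
  by apply: ler_wiXn2l; [lra|lra|exact: max_card].
apply: ler_prod => k kj; apply/andP; split; first by apply: mulr_ge0 => //; lra.
by rewrite addrAC sep_factor // sep // eq_sym.
Qed.

(** At x_j - r and x_j + r the polynomial P has opposite signs and absolute value at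
    least r (rho/2)^#|I|, which dominates c S; the intermediate value theorem gives
    the root. *)
Lemma pencil_roots (R : rcfType) (I : finType) (rho r K c : R) (a x : I -> R) :
  0 < rho <= 1 -> unit_cluster rho x -> 0 < r <= rho / 4 ->
  (forall j t, `|t| <= r -> `|interp a x (x j + t)| <= K) ->
  `|c| * K <= r * (rho / 2) ^+ #|I| ->
  exists y : I -> R, forall j,
    `|y j - x j| <= r /\ root (pencil a x c) (y j).
Proof.
move=> rho01 ux /andP[r0 rrho] SK cK.
suff near j : exists t : R, `|t - x j| <= r /\ root (pencil a x c) t.
  by have [y yP] := fin_all_exists near; exists y.
have /andP[rho0 _] := rho01.
(* The factor g (x j) normalizes the sign, so that q is nonpositive at x j - r and
   nonnegative at x j + r. *)
set g := conodal x j; pose q := (g (x j))%:P * pencil a x c.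
have g0 : g (x j) != 0.
  apply/prodf_neq0 => k kj; rewrite subr_eq0.
  by rewrite (inj_eq (unit_cluster_inj rho0 ux)) eq_sym.
have qE t : q.[x j + t] = t * (g (x j) * g (x j + t)) +
    g (x j) * (c * interp a x (x j + t)).
  rewrite hornerM hornerC horner_pencil (prod_conodal x j) -/g; ring.
have small t : `|t| <= r -> `|g (x j) * (c * interp a x (x j + t))| <=
    `|g (x j)| * (r * (rho / 2) ^+ #|I|).
  move=> tr; rewrite normrM ler_wpM2l // normrM (le_trans _ cK) // ler_wpM2l //.
  exact: SK.
have sign t : `|t| <= r ->
    `|g (x j)| * (rho / 2) ^+ #|I| <= g (x j) * g (x j + t).
  by move=> tr; apply: conodal_same_sign => //; lra.
have rr : `|r| <= r by rewrite ger0_norm // ltW.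
have Nrr : `|- r| <= r by rewrite normrN.
have r_le : x j - r <= x j + r by lra.
have /(poly_ivt r_le)[y /andP[yl yu]] : q.[x j - r] <= 0 <= q.[x j + r].
  rewrite !qE; apply/andP; split.
  + have := small _ Nrr; rewrite ler_norml => /andP[_ h1].
    have := ler_wpM2l (ltW r0) (sign _ Nrr) => h2; lra.
  + have := small _ rr; rewrite ler_norml => /andP[h1 _].
    have := ler_wpM2l (ltW r0) (sign _ rr) => h2; lra.
rewrite rootM => rooty; exists y; split; first by rewrite ler_norml; lra.
by move: rooty; rewrite rootC (negPf g0).
Qed.

(** The product S(y_j) Q'(y_j) is the inverse of the new amplitude. At y = x it is
    the inverse of a_j, and it is a weighted sum of products of differences of
    nodes, so [prod_lipschitz] compares the two. *)
Lemma interp_conodal_near (R : realFieldType) (I : finType) (m rho r : R)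
    (a x y : I -> R) (j : I) :
  0 < m -> 0 < rho <= 1 -> (forall k, m <= `|a k|) -> unit_cluster rho x ->
  0 <= r <= 4^-1 -> (forall k, `|y k - x k| <= r) ->
  `|interp a x (y j) * conodal y j (y j) - (a j)^-1|
    <= #|I|%:R * ((m * rho ^+ #|I| ^+ 2)^-1
         * (4 * #|I|%:R * 2 ^+ #|I| * 2 ^+ #|I| * r)).
Proof.
move=> m0 rho01 am ux /andP[r0 r4] yx; have /andP[rho0 _] := rho01.
have x01 := ux.1.
rewrite -(@interp_node _ _ a x j); last first.
  apply/prodf_neq0 => k kj; rewrite subr_eq0.
  by rewrite (inj_eq (unit_cluster_inj rho0 ux)) eq_sym.
rewrite /interp !mulr_suml -sumrB; apply: le_trans (ler_norm_sum _ _ _) _.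
rewrite mulr_natl -sumr_const; apply: ler_sum => k _.
rewrite -!mulrA -mulrBr normrM ler_pM ?interp_weight_le //.
have le2 : 1 <= 2 :> R by rewrite ler1n.
have e0 : 0 <= 2 * r by rewrite mulr_ge0.
have xx i k' : `|x i - x k'| <= 2.
  by rewrite ler_norml; have := x01 i; have := x01 k'; lra.
have yx2 i k' : `|y i - x k'| <= 2.
  move: (yx i); rewrite !ler_norml; have := x01 i; have := x01 k'; lra.
have yy i k' : `|y i - y k'| <= 2.
  move: (yx i) (yx k'); rewrite !ler_norml; have := x01 i; have := x01 k'; lra.
have d1 : `|conodal x k (y j) - conodal x k (x j)|
    <= #|I|%:R * 2 ^+ #|I| * (2 * r).
  apply: prod_lipschitz => // i _.
  move: (yx j); rewrite !ler_norml; lra.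
have d2 : `|conodal y j (y j) - conodal x j (x j)|
    <= #|I|%:R * 2 ^+ #|I| * (2 * r).
  apply: prod_lipschitz => // i _.
  move: (yx i) (yx j); rewrite !ler_norml; lra.
have b1 : `|conodal y j (y j)| <= 2 ^+ #|I| by exact: norm_prod_le.
have b2 : `|conodal x k (x j)| <= 2 ^+ #|I| by exact: norm_prod_le.
set A := conodal x k (y j) in d1 *; set A' := conodal x k (x j) in d1 b2 *.
set B := conodal y j (y j) in d2 b1 *; set B' := conodal x j (x j) in d2 *.
have -> : A * B - A' * B' = (A - A') * B + A' * (B - B') by ring.
apply: le_trans (ler_normD _ _) _; rewrite !normrM.
have h1 := ler_pM (normr_ge0 _) (normr_ge0 _) d1 b1.
have h2 := ler_pM (normr_ge0 _) (normr_ge0 _) b2 d2.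
apply: le_trans (lerD h1 h2) _.
by rewrite le_eqVlt; apply/orP; left; apply/eqP; ring.
Qed.

(** The bound on 1/b - 1/a is half of the least possible value of 1/|a|, so 1/b
    keeps the sign of 1/a and changes by a bounded factor. *)
Lemma amp_of_near_inv (R : realFieldType) (m M a b : R) :
  0 < m -> m <= `|a| <= M -> `|b^-1 - a^-1| <= (2 * M)^-1 ->
  [/\ b != 0, m / 2 <= `|b| <= 2 * M & (2 * M)^-1 <= Num.sg a * b^-1].
Proof.
move=> m0 /andP[ma aM] ba.
have a0 : 0 < `|a| := lt_le_trans m0 ma.
have M0 : 0 < M := lt_le_trans a0 aM.
have Ma : M^-1 <= `|a|^-1 by rewrite lef_pV2 ?posrE.
have am : `|a|^-1 <= m^-1 by rewrite lef_pV2 ?posrE.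
have M2 : (2 * M)^-1 = M^-1 / 2 by rewrite invfM mulrC.
have Mi : 0 < M^-1 by rewrite invr_gt0.
have sgb : (2 * M)^-1 <= Num.sg a * b^-1 <= 2 / m.
  have -> : Num.sg a * b^-1 = `|a|^-1 + Num.sg a * (b^-1 - a^-1).
    suff -> : Num.sg a * (b^-1 - a^-1) = Num.sg a * b^-1 - `|a|^-1.
      by rewrite addrC subrK.
    rewrite mulrBr; congr (_ - _).
    rewrite -[in LHS](mulfK (lt0r_neq0 a0) (Num.sg a)).
    by rewrite mulr_sg_norm mulrAC divff ?mul1r // -normr_gt0.
  have : `|Num.sg a * (b^-1 - a^-1)| <= (2 * M)^-1.
    by rewrite normrM normr_sg -normr_gt0 a0 mul1r.
  by rewrite M2 ler_norml; lra.
have b0 : b != 0.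
  apply: contraTneq sgb => ->; rewrite invr0 mulr0 M2; lra.
have bE : `|b|^-1 = Num.sg a * b^-1.
  rewrite -normfV -[LHS]mul1r -[X in X * _](_ : `|Num.sg a| = 1).
    rewrite -normrM ger0_norm //; case/andP: sgb => sgb _; apply: le_trans sgb.
    by rewrite M2; lra.
  by rewrite normr_sg -normr_gt0 a0.
move: sgb; rewrite -bE => /andP[s1 s2]; split => //.
have b0' : 0 < `|b| by rewrite normr_gt0.
move: s1 s2; rewrite -[2 / m]invf_div !lef_pV2 ?posrE ?divr_gt0 ?mulr_gt0 //.
by move=> -> ->.
Qed.

(** The sign of c is taken opposite to that of tau a_i0. Since P(y) = - c S(y) at
    y = y_i0, the displacement of this node is
    - c / (b_i0 Q'(y) prod_{k != i0} (y - x_k)); the last two factors have the same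
    sign, and b_i0 has the sign of a_i0, so the displacement has the sign of tau. *)
Lemma cluster_perturbation (R : rcfType) (I : finType) (m M rho : R) :
  0 < m -> m <= M -> 0 < rho <= 1 ->
  exists eta : R, 0 < eta /\
  forall a x : I -> R,
    (forall i, m <= `|a i| <= M) -> unit_cluster rho x ->
  forall (i0 : I) (tau : R), `|tau| = 1 ->
  exists b y : I -> R,
    [/\ forall i, m / 2 <= `|b i| <= 2 * M,
        forall i, `|y i - x i| <= rho / 4,
        eta <= tau * (y i0 - x i0) &
        forall p : {poly R}, (size p < #|I| + #|I|)%N ->
          \sum_i a i * p.[x i] = \sum_i b i * p.[y i]].
Proof.
move=> m0 mM rho01; have /andP[rho0 rho1] := rho01.
have M0 : 0 < M := lt_le_trans m0 mM.
set n := #|I|.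
set W := (m * rho ^+ n ^+ 2)^-1.
have W0 : 0 < W by rewrite invr_gt0 mulr_gt0 // !exprn_gt0.
set B := n%:R * (W * (4 * n%:R * 2 ^+ n * 2 ^+ n)).
have B0 : 0 <= B.
  by rewrite !mulr_ge0 // ?ler0n ?exprn_ge0 // ltW.
(* r bounds the displacements: the second bound keeps the amplitudes within
   the range that [amp_of_near_inv] asks for. *)
pose r := Num.min (rho / 4) (((B + 1) * (2 * M))^-1).
have r0 : 0 < r.
  rewrite lt_min; apply/andP; split; first by rewrite divr_gt0.
  by rewrite invr_gt0; apply: mulr_gt0; [exact: ltr_wpDl | exact: mulr_gt0].
have r_rho : r <= rho / 4 by rewrite ge_min lexx.
have Br : B * r <= (2 * M)^-1.
  apply: (@le_trans _ _ ((B + 1) * r)); first by rewrite ler_pM2r // lerDl.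
  rewrite mulrC -ler_pdivlMr ?ltr_wpDl // -invfM mulrC.
  by rewrite ge_min lexx orbT.
(* K bounds S near the cluster, and gam is the size of c; the 1 keeps K positive when
   there are no nodes. *)
set K := n%:R * W * 2 ^+ n + 1.
have K0 : 0 < K by rewrite ltr_wpDl // !mulr_ge0 // ?ler0n ?exprn_ge0 // ltW.
pose gam := r * (rho / 2) ^+ n / K.
have gam0 : 0 < gam by rewrite divr_gt0 // mulr_gt0 // exprn_gt0 // divr_gt0.
have two0 : 0 < 2 ^+ n :> R by rewrite exprn_gt0.
exists (gam * (2 * M)^-1 / (2 ^+ n * 2 ^+ n)); split.
  apply: divr_gt0; last exact: mulr_gt0.
  by apply: divr_gt0 => //; apply: mulr_gt0.
move=> a x amM ux i0 tau tau1.
have am k : m <= `|a k| by case/andP: (amM k).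
have a0 k : a k != 0 by rewrite -normr_gt0; exact: lt_le_trans (am k).
have x01 := ux.1.
pose c := - (gam * tau * Num.sg (a i0)).
have cN : `|c| = gam.
  rewrite normrN normrM (normrM gam) tau1 normr_sg a0 (gtr0_norm gam0).
  by rewrite mulr1 mulr1.
have [|||y yP] := @pencil_roots R I rho r K c a x rho01 ux.
- by rewrite r0.
- move=> j t tr; apply: (@le_trans _ _ (n%:R * W * 2 ^+ n)).
    apply: interp_le => // k; move: tr; rewrite !ler_norml.
    by have := x01 k; have := x01 j; lra.
  by rewrite lerDl.
- by rewrite cN /gam divfK // gt_eqF.
have yx k : `|y k - x k| <= r := (yP k).1.
have c0 : c != 0 by rewrite -normr_gt0 cN.
pose b j := (interp a x (y j) * conodal y j (y j))^-1.
have bP j := @amp_of_near_inv _ m M (a j) (b j) m0 (amM j).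
have nearb j : `|(b j)^-1 - (a j)^-1| <= (2 * M)^-1.
  rewrite invrK; apply: le_trans Br; apply: le_trans.
    apply: interp_conodal_near m0 rho01 am ux _ yx; lra.
  by rewrite le_eqVlt; apply/orP; left; apply/eqP; rewrite /B /W -/n; ring.
have injy : injective y.
  move=> i k yik; apply/eqP/negPn/negP => /(ux.2 _ _).
  move: (yx i) (yx k); rewrite yik !ler_norml => h1 h2.
  by apply/negP; rewrite -ltNge ltr_norml; lra.
have Sy0 j : interp a x (y j) != 0.
  have [b0 _ _] := bP j (nearb j).
  by move: b0; rewrite /b invr_eq0 mulf_eq0 negb_or => /andP[].
exists b, y; split.
- by move=> j; have [] := bP j (nearb j).
- by move=> j; apply: le_trans (yx j) _.
- have [_ _ sgb] := bP i0 (nearb i0).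
  set D := conodal y i0 (y i0); set N := conodal x i0 (y i0).
  (* y k and x k lie on the same side of y i0. *)
  have DN0 : 0 < D * N.
    rewrite /D /N /conodal -big_split /=; apply: prodr_gt0 => k ki.
    have := ux.2 _ _ ki; move: (yx k) (yx i0).
    rewrite !ler_norml ler_normr => /andP[h1 h2] /andP[h3 h4] /orP[h|h].
      by rewrite nmulr_rgt0; lra.
    by rewrite pmulr_rgt0; lra.
  have D2 : `|D| <= 2 ^+ n.
    apply: norm_prod_le => [|k _]; first by rewrite ler1n.
    move: (yx k) (yx i0); rewrite !ler_norml.
    by have := x01 k; have := x01 i0; lra.
  have N2 : `|N| <= 2 ^+ n.
    apply: norm_prod_le => [|k _]; first by rewrite ler1n.
    move: (yx k) (yx i0); rewrite !ler_norml.
    by have := x01 k; have := x01 i0; lra.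
  have DN2 : D * N <= 2 ^+ n * 2 ^+ n.
    by rewrite -(gtr0_norm DN0) normrM ler_pM.
  have /andP[D0 N0] : (D != 0) && (N != 0).
    by rewrite -negb_or -mulf_eq0 gt_eqF.
  have yx0 : (y i0 - x i0) * N = - (c * interp a x (y i0)).
    rewrite -prod_conodal; apply/eqP; rewrite -addr_eq0 -horner_pencil.
    exact: (yP i0).2.
  have SE : interp a x (y i0) = (b i0)^-1 / D by rewrite invrK mulfK.
  have tt : tau * tau = 1.
    by rewrite -expr2 -[LHS]ger0_norm ?sqr_ge0 // normrX tau1 expr1n.
  have -> : tau * (y i0 - x i0) = gam * (Num.sg (a i0) * (b i0)^-1) / (D * N).
    have -> : y i0 - x i0 = - (c * ((b i0)^-1 / D)) / N by rewrite -SE -yx0 mulfK.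
    rewrite /c; move: (b i0)^-1 => beta; rewrite -[gam in RHS]mul1r -tt.
    by field; rewrite D0 N0.
  have M2 : 0 <= (2 * M)^-1 by rewrite invr_ge0 mulr_ge0 // ltW.
  apply: ler_pM.
  - by rewrite mulr_ge0 // ltW.
  - by rewrite invr_ge0 ltW // mulr_gt0.
  - by rewrite ler_pM2l.
  - by rewrite lef_pV2 ?posrE // mulr_gt0.
move=> p sp.
apply: moments_eq c0 a0 (unit_cluster_inj rho0 ux) injy _ Sy0 sp => j.
exact: (yP j).2.
Qed.

(** * Trigonometric sums with vanishing moments *)

Lemma norm_le_of_derive_le (R : realType) (f f' : R -> R) (B : R) (n : nat) :
  f 0 = 0 -> (forall s, is_derive s (1 : R) f (f' s)) ->
  (forall s, `|f' s| <= B * `|s| ^+ n) ->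
  forall s, `|f s| <= B * `|s| ^+ n.+1.
Proof.
move=> f0 df f'B.
have cf : continuous f.
  by move=> t; apply: differentiable_continuous; apply/derivable1_diffP.
have bound (s c : R) : `|c| <= `|s| -> f s = f' c * s ->
    `|f s| <= B * `|s| ^+ n.+1.
  move=> cs ->; rewrite normrM exprSr mulrA ler_wpM2r //.
  have B0 : 0 <= B.
    by have := le_trans (normr_ge0 _) (f'B 1); rewrite normr1 expr1n mulr1.
  by apply: le_trans (f'B c) _; rewrite ler_wpM2l // lerXn2r ?nnegrE.
move=> s; have [s0|s0] := leP 0 s.
  have [c] := MVT_segment s0 (fun x _ => df x) (continuous_subspaceT cf).
  rewrite in_itv /= f0 !subr0 => /andP[c0 cs] fE.
  by apply: bound fE; rewrite !ger0_norm.
have [c] := MVT_segment (ltW s0) (fun x _ => df x) (continuous_subspaceT cf).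
rewrite in_itv /= f0 !sub0r mulrN => /andP[sc c0] /oppr_inj fE.
by apply: bound fE; rewrite (ler0_norm c0) (ltr0_norm s0) lerN2.
Qed.

Lemma is_derive_bigsum (R : realType) (I : Type) (r : seq I) (h : I -> R -> R)
    (dh : I -> R) (x : R) :
  (forall i, is_derive x (1 : R) (h i) (dh i)) ->
  is_derive x (1 : R) (fun t => \sum_(i <- r) h i t) (\sum_(i <- r) dh i).
Proof.
move=> dhP; elim: r => [|i r IH].
  rewrite big_nil (_ : (fun t => _) = cst 0); first exact: is_derive_cst.
  by apply/funext => t; rewrite big_nil.
rewrite big_cons (_ : (fun t => _) = h i + (fun t => \sum_(i <- r) h i t)).
  exact: is_deriveD.
by apply/funext => t; rewrite big_cons.
Qed.

Lemma is_derive_dilation (R : realType) (f : R -> R) (w z s df : R) :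
  is_derive (s * z) (1 : R) f df ->
  is_derive s (1 : R) (fun s => w * f (s * z)) (w * z * df).
Proof.
move=> fP; have dz : is_derive s (1 : R) (fun s : R => s * z) z.
  rewrite (_ : (fun s => _) = z \*: id); last first.
    by apply/funext => t; rewrite mulrC.
  rewrite -[X in is_derive _ _ _ X]mulr1; exact: is_deriveZ.
rewrite mulrAC -mulrA.
exact: (is_deriveZ w (@is_derive1_comp R f (fun s : R => s * z) s _ _ fP dz)).
Qed.

(** Differentiating the cosine sum replaces w_i by w_i z_i and yields a sine sum,
    and conversely; the new weights satisfy one moment condition less. The moment
    of order 0 says that the cosine sum vanishes at s = 0, hence the mean value
    theorem gains one power of s at each step. The two sums are treated together
    because they exchange their roles. *)
Lemma trig_sum_le (R : realType) (I : finType) (n : nat) (w z : I -> R) :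
  (forall k, (k < n)%N -> \sum_i w i * z i ^+ k = 0) ->
  forall s, `|\sum_i w i * cos (s * z i)|
              <= (\sum_i `|w i| * `|z i| ^+ n) * `|s| ^+ n /\
            `|\sum_i w i * sin (s * z i)|
              <= (\sum_i `|w i| * `|z i| ^+ n) * `|s| ^+ n.
Proof.
elim: n w => [|n IH] w mom.
  move=> s; rewrite expr0 mulr1.
  split; apply: le_trans (ler_norm_sum _ _ _) _; apply: ler_sum => i _;
    by rewrite normrM expr0 ler_wpM2l // ler_norml
      ?cos_geN1 ?cos_le1 ?sin_geN1 ?sin_le1.
have mom' k : (k < n)%N -> \sum_i (w i * z i) * z i ^+ k = 0.
  move=> kn; rewrite -[RHS](mom k.+1 kn); apply: eq_bigr => i _.
  by rewrite -mulrA -exprS.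
have BE : \sum_i `|w i * z i| * `|z i| ^+ n = \sum_i `|w i| * `|z i| ^+ n.+1.
  by apply: eq_bigr => i _; rewrite normrM -mulrA -exprS.
move=> s; have {}IH := IH _ mom'; rewrite BE in IH; split.
- apply: (@norm_le_of_derive_le _ (fun s => \sum_i w i * cos (s * z i))
    (fun s => \sum_i w i * z i * - sin (s * z i))).
  + rewrite -[RHS](mom 0%N) //; apply: eq_bigr => i _.
    by rewrite mul0r cos0 expr0.
  + move=> t; apply: is_derive_bigsum => i.
    exact: (is_derive_dilation _ (is_derive_cos _)).
  + move=> t; under eq_bigr do rewrite mulrN.
    by rewrite sumrN normrN; exact: (IH t).2.
- apply: (@norm_le_of_derive_le _ (fun s => \sum_i w i * sin (s * z i))
    (fun s => \sum_i (w i * z i * cos (s * z i)))).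
  + by rewrite big1 // => i _; rewrite mul0r sin0 mulr0.
  + move=> t; apply: is_derive_bigsum => i.
    exact: (is_derive_dilation _ (is_derive_sin _)).
  + by move=> t; exact: (IH t).1.
Qed.

Lemma expiD (R : realType) (s t : R) : expi (s + t) = expi s * expi t.
Proof. by rewrite /expi cosD sinD; simpc; congr (_ +i* _); rewrite addrC. Qed.

Lemma norm_complex_le (R : rcfType) (x y : R) :
  `|x +i* y| <= (`|x| + `|y|)%:C.
Proof.
rewrite normc_def lecR /= -[leRHS]ger0_norm ?addr_ge0 // -[leRHS]sqrtr_sqr.
rewrite ler_wsqrtr // sqrrD !real_normK ?num_real //.
by rewrite -addrA lerD2l lerDr mulrn_wge0 // mulr_ge0.
Qed.

Lemma norm_expi (R : realType) (t : R) : `|expi t| = 1.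
Proof. by rewrite normc_def /= cos2Dsin2 sqrtr1. Qed.

Lemma sum_expi (R : realType) (I : finType) (w z : I -> R) (t : R) :
  \sum_i (w i)%:C * expi (t * z i) =
  (\sum_i w i * cos (t * z i)) +i* (\sum_i w i * sin (t * z i)).
Proof.
apply: (big_rec3 (fun x y u : _ => x = (y : R) +i* (u : R))) => // i u v x _ ->.
by rewrite /expi; simpc.
Qed.

(** The common phase exp(-i s o) factors out, which leaves trigonometric sums over
    the disjoint union of the two families of nodes. *)
Lemma fourier_diff_le (R : realType) (I : finType) (n : nat) (o h C s : R)
    (a b x y : I -> R) :
  (forall k, (k < n)%N -> \sum_i a i * x i ^+ k = \sum_i b i * y i ^+ k) ->
  \sum_i `|a i| * `|x i| ^+ n + \sum_i `|b i| * `|y i| ^+ n <= C ->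
  `|\sum_i (a i)%:C * expi (- (s * (o + h * x i)))
    - \sum_i (b i)%:C * expi (- (s * (o + h * y i)))|
  <= (2 * C * `|h * s| ^+ n)%:C.
Proof.
move=> mom le_C.
pose w (u : I + I) := match u with inl i => a i | inr i => - b i end.
pose z (u : I + I) := match u with inl i => x i | inr i => y i end.
have shift (c v : I -> R) : \sum_i (c i)%:C * expi (- (s * (o + h * v i))) =
    expi (- (s * o)) * \sum_i (c i)%:C * expi (- (h * s) * v i).
  rewrite mulr_sumr; apply: eq_bigr => i _; rewrite mulrCA -expiD.
  by congr (_ * expi _); ring.
rewrite !shift -mulrBr normrM norm_expi mul1r.
have -> : \sum_i (a i)%:C * expi (- (h * s) * x i)
          - \sum_i (b i)%:C * expi (- (h * s) * y i)
        = \sum_u (w u)%:C * expi (- (h * s) * z u).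
  rewrite big_sumType /= -sumrN; congr (_ + _); apply: eq_bigr => i _.
  by rewrite -mulNr; congr (_ * _); rewrite -(rmorphN (real_complex R)).
rewrite sum_expi; apply: le_trans (norm_complex_le _ _) _; rewrite lecR.
have [|c1 c2] := @trig_sum_le R _ n w z _ (- (h * s)).
  move=> k kn; rewrite big_sumType /=; apply/eqP.
  rewrite (mom k kn) -big_split big1 // => i _; by rewrite /= mulNr subrr.
apply: le_trans (lerD c1 c2) _; rewrite normrN -mulrDl ler_wpM2r //.
  by rewrite exprn_ge0.
rewrite big_sumType /= mulr_natl mulr2n.
by apply: lerD; under [X in _ + X <= _]eq_bigr do rewrite normrN.
Qed.

(** * Sorting displaced nodes *)

Lemma exists_sorting_perm (R : realDomainType) (n : nat) (z : 'I_n -> R) :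
  exists p : {perm 'I_n}, {homo z \o p : i j / (i <= j)%N >-> i <= j}.
Proof.
pose le_z : rel 'I_n := relpre z <=%O.
have le_z_total : total le_z by move=> i j; exact: le_total.
have le_z_trans : transitive le_z by move=> i j k; exact: le_trans.
have /tuple_permP[p pE] : perm_eq (sort le_z (ord_tuple n)) (ord_tuple n).
  by rewrite perm_sort.
exists p => i j ij.
have := sorted_leq_nth le_z_trans (fun i => lexx (z i)) i
  (sort_sorted le_z_total (ord_tuple n)).
move=> /(_ i j); rewrite !inE size_sort size_tuple !ltn_ord => /(_ isT isT ij).
by rewrite pE -!tnth_nth !tnth_mktuple !tnth_ord_tuple.
Qed.

(** Otherwise p would map the k + 1 positions up to k into the k indices below k. *)
Lemma sorting_perm_ge (R : realDomainType) (n : nat) (z : 'I_n -> R)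
    (p : {perm 'I_n}) (k : 'I_n) (v : R) :
  {homo z \o p : i j / (i <= j)%N >-> i <= j} ->
  (forall i : 'I_n, (k <= i)%N -> v <= z i) -> v <= z (p k).
Proof.
move=> mono vz; rewrite leNgt; apply/negP => zv.
have sub : p @: [set i : 'I_n | (i <= k)%N] \subset [set i : 'I_n | (i < k)%N].
  apply/subsetP => _ /imsetP[i + ->]; rewrite !inE => ik.
  rewrite ltnNge; apply/negP => /vz; rewrite leNgt => /negP; apply.
  exact: le_lt_trans (mono _ _ ik) zv.
have := subset_leq_card sub; rewrite card_imset; last exact: perm_inj.
apply/negP; rewrite -ltnNge proper_card //; apply/properP; split.
  by apply/subsetP => i; rewrite !inE; exact: ltnW.
by exists k; rewrite !inE ?ltnn.
Qed.

Lemma sorting_perm_le (R : realDomainType) (n : nat) (z : 'I_n -> R)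
    (p : {perm 'I_n}) (k : 'I_n) (v : R) :
  {homo z \o p : i j / (i <= j)%N >-> i <= j} ->
  (forall i : 'I_n, (i <= k)%N -> z i <= v) -> z (p k) <= v.
Proof.
move=> mono zv; rewrite leNgt; apply/negP => vz.
have sub : p @: [set i : 'I_n | (k <= i)%N] \subset [set i : 'I_n | (k < i)%N].
  apply/subsetP => _ /imsetP[i + ->]; rewrite !inE => ki.
  rewrite ltnNge; apply/negP => /zv; rewrite leNgt => /negP; apply.
  exact: lt_le_trans vz (mono _ _ ki).
have := subset_leq_card sub; rewrite card_imset; last exact: perm_inj.
apply/negP; rewrite -ltnNge proper_card //; apply/properP; split.
  by apply/subsetP => i; rewrite !inE; exact: ltnW.
by exists k; rewrite !inE ?ltnn.
Qed.

(** Sorting the nodes permutes the terms of the signal and leaves its Fourier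
    transform unchanged. *)
Lemma exists_signal (R : realType) (d : nat) (b z : 'I_d -> R) :
  exists (F : signal R d) (p : {perm 'I_d}),
    [/\ {homo z \o p : i j / (i <= j)%N >-> i <= j},
        forall i, amp F 0 i = b (p i),
        forall i, node F 0 i = z (p i) &
        forall s, fourier F s = \sum_i (b i)%:C * expi (- (s * z i))].
Proof.
have [p mono] := exists_sorting_perm z.
have ord (i j : 'I_d) : (i <= j)%N ->
    (\row_i z (p i)) 0 i <= (\row_i z (p i)) 0 j.
  by move=> ij; rewrite !mxE; exact: mono.
exists (Signal (\row_i b (p i)) ord), p; split=> // [i|i|s]; rewrite ?mxE //.
rewrite /fourier [RHS](reindex_inj (@perm_inj _ p)) /=.
by apply: eq_bigr => i _; rewrite !mxE.
Qed.

(** * The cluster inside a signal *)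

Definition override (I J : finType) (T : Type) (inj : J -> I) (f : I -> T)
    (g : J -> T) (i : I) : T :=
  if [pick s | inj s == i] is Some s then g s else f i.

Lemma override_in (I J : finType) (T : Type) (inj : J -> I) (f : I -> T)
    (g : J -> T) (s : J) :
  injective inj -> override inj f g (inj s) = g s.
Proof.
move=> injP; rewrite /override; case: pickP => [t /eqP/injP -> //|/(_ s)].
by rewrite eqxx.
Qed.

Lemma override_out (I J : finType) (T : Type) (inj : J -> I) (f : I -> T)
    (g : J -> T) (i : I) :
  (forall s, inj s != i) -> override inj f g i = f i.
Proof. by rewrite /override; case: pickP => // s + /(_ s); move=> ->. Qed.

Lemma sum_override_diff (I J : finType) (V : zmodType) (inj : J -> I)
    (f f' : I -> V) :
  injective inj -> (forall i, (forall s, inj s != i) -> f i = f' i) ->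
  \sum_i f i - \sum_i f' i = \sum_s f (inj s) - \sum_s f' (inj s).
Proof.
move=> injP ff'; rewrite -!sumrB.
rewrite (bigID [in inj @: J]) /= [X in _ + X]big1 ?addr0; last first.
  move=> i iJ; rewrite ff' ?subrr // => s; apply: contraNneq iJ => <-.
  exact: imset_f.
by rewrite big_imset //= => s t _ _; exact: injP.
Qed.

Definition cluster_index (d kappa l : nat) (kl_le_d : (kappa + l <= d)%N)
    (s : 'I_l) : 'I_d :=
  widen_ord kl_le_d (rshift kappa s).

Lemma cluster_index_inj (d kappa l : nat) (kl_le_d : (kappa + l <= d)%N) :
  injective (cluster_index kl_le_d).
Proof. by move=> s t /(congr1 val) /= /addnI /val_inj. Qed.

Lemma cluster_indexP (d kappa l : nat) (kl_le_d : (kappa + l <= d)%N) (i : 'I_d) :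
  (exists s, i = cluster_index kl_le_d s) \/
  (forall s, cluster_index kl_le_d s != i) /\ (i < kappa \/ kappa + l <= i)%N.
Proof.
have [ik|ki] := ltnP i kappa.
  right; split=> [s|]; last by left.
  by apply: contraTneq ik => <-; rewrite -leqNgt leq_addr.
have [il|li] := ltnP i (kappa + l).
  left; have il' : (i - kappa < l)%N by rewrite ltn_subLR.
  by exists (Ordinal il'); apply: val_inj; rewrite /= subnKC.
right; split=> [s|]; last by right.
by apply: contraTneq li => <-; rewrite -ltnNge /= ltn_add2l.
Qed.

(** A node outside the cluster lies outside the interval, but possibly at its very
    end. The last clause says that the first node of the cluster can nevertheless
    move by rho / 2 in one direction without crossing an outside node. To the
    right there is room if the node is in the left half of the interval, or if a
    second cluster node is between it and the right end. If neither holds, it is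
    alone, and the left half of the interval is free. *)
Lemma cluster_rescale (R : realType) (d kappa l : nat)
    (kl_le_d : (kappa + l <= d)%N) (h rho : R) (F : signal R d) (i0 : 'I_l) :
  0 < h -> 0 < rho <= 1 -> val i0 = 0%N -> forms_cluster kl_le_d h rho F ->
  exists (o : R) (x : 'I_l -> R),
    [/\ forall s, node F 0 (cluster_index kl_le_d s) = o + h * x s,
        unit_cluster rho x,
        forall s, s != i0 -> x i0 + rho <= x s &
        (forall i : 'I_d, (kappa + l <= i)%N ->
           o + h * (x i0 + rho / 2) <= node F 0 i) \/
        (forall s, s = i0) /\
        (forall i : 'I_d, (i < kappa)%N ->
           node F 0 i <= o + h * (x i0 - rho / 2))].
Proof.
move=> h0 /andP[rho0 rho1] i00 [[o [b1 [b2 itv]]] sep].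
pose c := cluster_index kl_le_d.
pose x s := (node F 0 (c s) - o) / h.
have hn0 : h != 0 by rewrite gt_eqF.
have xE s : node F 0 (c s) = o + h * x s.
  by rewrite /x mulrCA divff // mulr1 addrC subrK.
have incluster s : o <= node F 0 (c s) <= o + h.
  have := itv (c s); rewrite /= leq_addr ltn_add2l ltn_ord /=.
  rewrite itv_boundlr => /andP[].
  by case: b1 b2 {itv} => [] []; rewrite !bnd_simp => u v; rewrite ?u ?v ?ltW.
have x01 s : 0 <= x s <= 1.
  have /andP[lo hi] := incluster s.
  by rewrite divr_ge0 ?subr_ge0 ?(ltW h0) // ler_pdivrMr // mul1r lerBlDl.
have right_out (i : 'I_d) : (kappa + l <= i)%N -> o + h <= node F 0 i.
  move=> li; have := itv (c i0); have := itv i.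
  rewrite /= leq_addr ltn_add2l ltn_ord /= [(i < _)%N]ltnNge li andbF.
  have : node F 0 (c i0) <= node F 0 i.
    by apply: node_ordered; rewrite /= i00 addn0 (leq_trans (leq_addr l _)).
  rewrite !itv_boundlr => ci /negbT; rewrite negb_and => out /andP[low _].
  have {}low : (BSide b1 o <= BLeft (node F 0 i))%O by exact: le_trans low _.
  by move: out; rewrite low /= -ltNge; case: b2 {itv} => //;
    rewrite !bnd_simp // => /ltW.
have left_out (i : 'I_d) : (i < kappa)%N -> node F 0 i <= o.
  move=> ik; have := itv (c i0); have := itv i.
  rewrite /= leq_addr ltn_add2l ltn_ord /= [(kappa <= _)%N]leqNgt ik /=.
  have : node F 0 i <= node F 0 (c i0).
    by apply: node_ordered; rewrite /= i00 addn0 ltnW.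
  rewrite !itv_boundlr => ci /negbT; rewrite negb_and => out /andP[_ up].
  have {}up : (BRight (node F 0 i) <= BSide b2 (o + h))%O by exact: le_trans up.
  by move: out; rewrite up orbF -ltNge; case: b1 {itv} => //;
    rewrite !bnd_simp // => /ltW.
have xsep u v : u != v -> rho <= `|x u - x v|.
  move=> /sep; rewrite !mxE -/(cluster_index _ _) -/(cluster_index _ _) -/c !xE.
  rewrite (_ : _ - _ = (x u - x v) * h); last by ring.
  by rewrite normrM (gtr0_norm h0) ler_pM2r.
have first_le u : u != i0 -> x i0 + rho <= x u.
  move=> ui0; have := xsep _ _ ui0; rewrite ger0_norm; first by rewrite lerBrDl.
  rewrite subr_ge0 ler_pM2r ?invr_gt0 // lerD2r.
  by apply: node_ordered; rewrite /= i00 addn0 leq_addr.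
exists o, x; split=> //.
have [x_lo|x_hi] := leP (x i0) 2^-1.
  left=> i /right_out; apply: le_trans; rewrite lerD2l ler_piMr ?(ltW h0) //; lra.
have [/forallP one|/forallPn[s si0]] := boolP [forall s, s == i0].
  right; split=> [s|i /left_out ion]; first exact/eqP.
  by apply: le_trans ion _; rewrite lerDl mulr_ge0 ?(ltW h0) //; lra.
left=> i /right_out; apply: le_trans; rewrite lerD2l ler_piMr ?(ltW h0) //.
by have := first_le _ si0; have := x01 s; lra.
Qed.

(** * Two close signals and the lower bound for algorithms *)

Lemma dist_nodes_ge (R : realType) (q : nat) (V W : 'rV[R]_q) (s : 'I_q) :
  `|V 0 s - W 0 s| <= dist_nodes V W.
Proof. exact: (le_bigmax _ (fun s => `|V 0 s - W 0 s|)). Qed.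

Lemma dist_nodes_triangle (R : realType) (q : nat) (U V W : 'rV[R]_q) :
  dist_nodes U V <= dist_nodes U W + dist_nodes V W.
Proof.
have dist0 (X Y : 'rV[R]_q) : 0 <= dist_nodes X Y.
  by apply: (big_ind (fun u => 0 <= u)) => // u v u0 v0; rewrite le_max u0.
apply/bigmax_leP; split=> [|s _]; first by rewrite addr_ge0.
rewrite (_ : U 0 s - V 0 s = (U 0 s - W 0 s) - (V 0 s - W 0 s)); last by ring.
by apply: le_trans (ler_normB _ _) _; rewrite lerD ?dist_nodes_ge.
Qed.

(** The nodes of the cluster are displaced by [cluster_perturbation], all others
    are kept, and the result is sorted. The displaced nodes stay between -1 and 2 in
    rescaled coordinates, which bounds the constant in [fourier_diff_le]. *)
Lemma close_signal (R : realType) (m M rho : R) (l : nat) :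
  0 < m -> m <= M -> 0 < rho -> (1 <= l)%N ->
  exists C1 C2 : R, [/\ 0 < C1, 0 < C2 &
    forall (d kappa : nat) (kl_le_d : (kappa + l <= d)%N) (h : R)
      (F0 : signal R d),
      0 < h -> amp_assumption m M F0 -> forms_cluster kl_le_d h rho F0 ->
      exists F1 : signal R d,
        [/\ amp_assumption (m / 2) (2 * M) F1,
            C1 * h <= dist_nodes (subnodes kl_le_d (node F0))
                                 (subnodes kl_le_d (node F1)) &
            forall s : R, `|fourier F0 s - fourier F1 s|
                <= (C2 * `|h * s| ^+ (2 * l - 1))%:C]].
Proof.
move=> m0 mM rho0 l1.
(* For a cluster of one node rho may exceed 1. *)
pose rho' := Num.min rho 1.
have rho'01 : 0 < rho' <= 1 by rewrite lt_min rho0 ltr01 ge_min lexx orbT.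
have /andP[rho'0 rho'1] := rho'01.
have M0 : 0 < M := lt_le_trans m0 mM.
pose i0 := Ordinal l1.
have [eta [eta0 perturb]] := @cluster_perturbation R 'I_l m M rho' m0 mM rho'01.
set n := (2 * l - 1)%N.
pose B := l%:R * (2 * M * 2 ^+ n).
have B0 : 0 < B by rewrite !mulr_gt0 ?exprn_gt0 // ltr0n.
exists eta, (2 * (B + B)); split=> //; first by rewrite mulr_gt0 ?addr_gt0.
move=> d kappa kl h F0 h0 [_ ampF] clF.
have clF' : forms_cluster kl h rho' F0.
  case: clF => itv sep; split=> // s t /sep; apply: le_trans.
  by rewrite ler_pM2r // ge_min lexx.
pose c := cluster_index kl.
have [o [x [xE ux first_lt room]]] :=
  cluster_rescale h0 rho'01 (erefl : val i0 = 0%N) clF'.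
have injc : injective c := @cluster_index_inj _ _ _ kl.
have x01 := ux.1.
pose a s := amp F0 0 (c s).
have aP s : m <= `|a s| <= M by exact: ampF.
have tau1 (right : bool) : `|if right then 1 else -1 : R| = 1.
  by case: right; rewrite ?normrN normr1.
pose right_room := forall i : 'I_d, (kappa + l <= i)%N ->
  o + h * (x i0 + rho' / 2) <= node F0 0 i.
have [b [y [bP yx disp mom]]] := perturb a x aP ux i0 _ (tau1 `[< right_room >]).
pose z := override c (node F0 0) (fun s => o + h * y s).
pose b' := override c (amp F0 0) b.
have [F1 [p [mono ampE nodeE fourE]]] := exists_signal b' z.
have zc s : z (c s) = o + h * y s by exact: override_in.
have yx2 s : x s - rho' / 4 <= y s <= x s + rho' / 4.
  by have := yx s; rewrite ler_norml; lra.
exists F1; split.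
- split=> [|j]; first by rewrite divr_gt0.
  rewrite ampE; have [[s ->]|[out _]] := cluster_indexP kl (p j).
    by rewrite /b' override_in.
  rewrite /b' override_out //; have /andP[lo hi] := ampF (p j).
  by apply/andP; split; lra.
- apply: le_trans (dist_nodes_ge _ _ i0).
  rewrite !mxE -/(cluster_index kl i0) -/c xE nodeE.
  have hdisp (u v : R) : u <= v -> h * u <= h * v by rewrite ler_pM2l.
  move: disp; case: asboolP => [right|not_right].
    rewrite mul1r => /hdisp disp.
    suff ge_z : z (c i0) <= z (p (c i0)).
      by rewrite distrC (le_trans _ (ler_norm _)) //; rewrite zc in ge_z; lra.
    apply: (sorting_perm_ge mono) => i; rewrite /= addn0 => ki; rewrite zc.
    have [[s ->]|[out [ik|li]]] := cluster_indexP kl i.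
    + rewrite zc lerD2l ler_pM2l //; have [->//|si0] := eqVneq s i0.
      by have := first_lt _ si0; have := yx2 s; have := yx2 i0; lra.
    + by rewrite leqNgt ik in ki.
    + rewrite /z override_out //; apply: le_trans (right i li).
      by rewrite lerD2l ler_pM2l //; have := yx2 i0; lra.
  rewrite mulN1r opprB => /hdisp disp.
  case: room => [/not_right //|[one left]].
  suff le_z : z (p (c i0)) <= z (c i0).
    by rewrite (le_trans _ (ler_norm _)) //; rewrite zc in le_z; lra.
  apply: (sorting_perm_le mono) => i; rewrite /= addn0 => ik; rewrite zc.
  have [[s ->]|[out]] := cluster_indexP kl i; first by rewrite (one s) zc.
  rewrite /z override_out // leq_eqVlt in ik *.
  move=> [ik'|li].
    apply: le_trans (left i ik') _.
    by rewrite lerD2l ler_pM2l //; have := yx2 i0; lra.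
  have : (kappa + l <= kappa)%N.
    by apply: leq_trans li _; case/orP: ik => [/eqP->|/ltnW].
  by rewrite -[X in (_ <= X)%N]addn0 leq_add2l leqNgt l1.
move=> s; rewrite fourE /fourier.
rewrite (@sum_override_diff _ _ _ c) //; last first.
  by move=> i out; rewrite /b' /z !override_out.
under eq_bigr do rewrite xE.
under [X in _ - X]eq_bigr do rewrite zc /b' override_in //.
apply: fourier_diff_le => [k kn|].
  have := mom 'X^k; rewrite size_polyXn !card_ord => /(_ _).
  under eq_bigr do rewrite hornerXn.
  under [X in _ = X]eq_bigr do rewrite hornerXn.
  apply; move: kn; rewrite /n addnn -mul2n.
  by case: (2 * l)%N => // q; rewrite subn1.
have sum_le (e u : 'I_l -> R) : (forall i, `|e i| <= 2 * M) ->
    (forall i, `|u i| <= 2) -> \sum_i `|e i| * `|u i| ^+ n <= B.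
  move=> eM u2; rewrite /B mulr_natl -[X in _ *+ X]card_ord -sumr_const.
  apply: ler_sum => i _; apply: ler_pM => //; first by rewrite exprn_ge0.
  by rewrite lerXn2r ?nnegrE.
apply: lerD; apply: sum_le => i.
- by have /andP[_ hi] := aP i; lra.
- by have := x01 i; rewrite ler_norml; lra.
- by have /andP[_ hi] := bP i.
- by have := x01 i; have := yx2 i; rewrite ler_norml; lra.
Qed.

Theorem mainTheorem2 (R : realType) (m M rho : R) (l : nat) :
  0 < m -> m <= M -> 0 < rho -> (1 <= l)%N ->
  exists C1 C2 eps0 : R,
    [/\ 0 < C1, 0 < C2, 0 < eps0 &
    forall N eps : R, 0 < N -> 0 < eps -> eps <= eps0 ->
    let h := N^-1 * (eps / C2) `^ ((2 * l - 1)%:R^-1) in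
    forall (d kappa : nat) (kl_le_d : (kappa + l <= d)%N) (F0 : signal R d),
      (l <= d)%N ->
      amp_assumption m M F0 ->
      forms_cluster kl_le_d h rho F0 ->
      exists F1 : signal R d,
        [/\ amp_assumption (m / 2) (2 * M) F1,
            C1 * h <= dist_nodes (subnodes kl_le_d (node F0))
                                 (subnodes kl_le_d (node F1)),
            forall s : R, `|s| <= (2 * pi * h)^-1 ->
              `|fourier F0 s - fourier F1 s|
                <= (C2 * `|h * s| ^+ (2 * l - 1))%:C
          & forall Rec : algorithm N d,
              exists (i : bool) (nu : measured N),
                let F := if i then F1 else F0 in
                admissible_noise eps nu /\
                2^-1 * C1 * h <=
                  dist_nodes (subnodes kl_le_d (node F))
                    (subnodes kl_le_d (Rec (measurement F nu)).2)]].
Proof.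
move=> m0 mM rho0 l1.
have [C1 [C2 [C10 C20 close]]] := close_signal m0 mM rho0 l1.
exists C1, C2, 1; split=> // N eps N0 eps0 _ h d kappa kl F0 _ ampF clF.
have q0 : 0 < eps / C2 by rewrite divr_gt0.
have h0 : 0 < h by rewrite mulr_gt0 ?invr_gt0 ?powR_gt0.
have [F1 [ampF1 dist01 fourier01]] := close d kappa kl h F0 h0 ampF clF.
exists F1; split=> // Rec.
have n0 : (2 * l - 1)%:R != 0 :> R.
  by rewrite pnatr_eq0 -lt0n subn_gt0; case: (l) l1 => // k _; rewrite mulnS.
have hN : C2 * (h * N) ^+ (2 * l - 1) = eps.
  rewrite /h mulrAC mulVf ?gt_eqF // mul1r -powR_mulrn ?powR_ge0 // -powRrM.
  by rewrite mulVf // powRr1 ?ltW // mulrCA divff ?mulr1 // gt_eqF.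
(* With this noise F1 yields the noiseless measurement of F0. *)
pose nu : measured N := fun s => fourier F0 (val s) - fourier F1 (val s).
have meas : measurement F1 nu = measurement F0 (fun=> 0).
  by apply/funext => s; rewrite /measurement /nu addr0 addrC subrK.
set X := subnodes kl (Rec (measurement F0 (fun=> 0))).2.
have [far0|near0] := leP (2^-1 * C1 * h) (dist_nodes (subnodes kl (node F0)) X).
  exists false, (fun=> 0); split=> // s; rewrite normr0 lecR; exact: ltW.
exists true, nu; split=> [s|]; last first.
  rewrite meas -/X.
  have := le_trans dist01 (dist_nodes_triangle _ _ X).
  by move: near0; rewrite -!mulrA; lra.
apply: le_trans (fourier01 (val s)) _; rewrite lecR -hN ler_wpM2l ?(ltW C20) //.
have := valP s; rewrite in_itv /= -ler_norml => sN.
have hs : `|h * val s| <= h * N by rewrite normrM (gtr0_norm h0) ler_pM2l.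
by rewrite lerXn2r // nnegrE (le_trans _ hs).
Qed.
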